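(* Let $\phi_{\mathrm{xor}}$ be a conjunction of xor-constraints such that each variable occurs in at most three xor-constraints of $\phi_{\mathrm{xor}}$. (1) If $\phi_{\mathrm{xor}}$ is unsatisfiable, then there is a UP-derivation on $\phi_{\mathrm{xor}}\land y_1\land\dots\land y_m$ for some $y_1,\dots,y_m\in\mathrm{vars}(\phi_{\mathrm{xor}})$, a vertex $v$ with $L(v)=(\bot\equiv\top)$ in it, and a cut $W$ for $v$ such that $\mathrm{pexpl}(v,W)=(\bot\equiv\bot)$, and thus $\mathrm{pexpl}(v,W)+L(v)=(\bot\equiv\top)$. (2) If $\phi_{\mathrm{xor}}$ is satisfiable and $\phi_{\mathrm{xor}}\models(x_1\oplus\dots\oplus x_k\equiv p)$, then there is a UP-derivation on $\phi_{\mathrm{xor}}\land(x_1\equiv p_1)\land\dots\land(x_k\equiv p_k)\land y_1\land\dots\land y_m$ for some parities $p_1,\dots,p_k$ and some $y_1,\dots,y_m\in\mathrm{vars}(\phi_{\mathrm{xor}})\setminus\{x_1,\dots,x_k\}$, a vertex $v$ with $L(v)=(\bot\equiv\top)$ in it, and a cut $W$ for $v$ such that $\mathrm{pexpl}(v,W)+L(v)=(x'_1\oplus\dots\oplus x'_l\equiv p')$ for some $\{x'_1,\dots,x'_l\}\subseteq\{x_1,\dots,x_k\}$ and $p'\in\{\bot,\top\}$ with $\phi_{\mathrm{xor}}\models(x'_1\oplus\dots\oplus x'_l\equiv p')$.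
   Context: An xor-constraint is an equation $x_1\oplus\dots\oplus x_k\equiv p$ with Boolean variables and $p\in\{\bot,\top\}$; duplicate variables cancel in pairs; $\bot\equiv\bot$ is identified with $\top$, $\bot\equiv\top$ with $\bot$, $x\equiv\top$ with the literal $x$, $x\equiv\bot$ with $\neg x$. The linear combination of $D=(x_1\oplus\dots\oplus x_k\equiv p)$ and $E=(y_1\oplus\dots\oplus y_l\equiv q)$ is $D+E=(x_1\oplus\dots\oplus x_k\oplus y_1\oplus\dots\oplus y_l\equiv p\oplus q)$ (with cancellation). $D[x/p]$ denotes substituting variable $x$ by the constant $p$ in $D$. The UP rules are: from $x\equiv\top$ and an xor-constraint $D$ containing $x$ infer $D[x/\top]$; from $x\equiv\bot$ and $D$ containing $x$ infer $D[x/\bot]$. A UP-derivation on a conjunction $\psi$ of xor-constraints is a vertex-labelled DAG $G=\langle V,E,L\rangle$ whose input vertices (no incoming edges) are labelled with xor-constraints of $\psi$ and in which every other vertex $v$ has exactly two incoming edges, from $v',v''$, with $L(v)$ obtained from $L(v'),L(v'')$ by a UP rule. Here $\psi=\phi_{\mathrm{xor}}\land l_1\land\dots\land l_r$ where the unit constraints $l_i$ are called xor-assumptions (a variable $y$ used as an assumption means $y\equiv\top$). A cut for a non-input vertex $v$ is a partition $W=(V_a,V_b)$ of $V$ with $v\in V_b$ such that every input vertex from which there is a path to $v$ lies in $V_a$. The parity explanation is $\mathrm{pexpl}(v,W)=f_W(v)$ where: if $u$ is an input vertex with $L(u)\in\phi_{\mathrm{xor}}$, $f_W(u)=\top$ (i.e.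 $\bot\equiv\bot$); if $u$ is an input vertex labelled with an xor-assumption, $f_W(u)=L(u)$; if $u$ is a non-input vertex in $V_a$, $f_W(u)=L(u)$; if $u$ is a non-input vertex in $V_b$, $f_W(u)=f_W(u_1)+f_W(u_2)$ where $u_1,u_2$ are the sources of the two edges entering $u$.
   Formalization: Part (1) assumes the constraint ⊥≡⊤ is not itself a conjunct of φ_xor, and part (2) assumes k ≥ 1; the literal claims fail for φ_xor = (⊥≡⊤) and for empty φ_xor with k = 0, since then no non-input vertex, hence no cut, exists. *)

(* Defs.v *)
From HB Require Import structures.
From mathcomp Require Import all_boot finmap.

Set Implicit Arguments.
Unset Strict Implicit.
Unset Printing Implicit Defensive.

Local Open Scope fset_scope.

(* An xor-constraint x_1 (+) ... (+) x_k == p is the pair ({x_1, ..., x_k}, p).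
   Having a finite set on the left builds in the cancellation of duplicate
   variables; a conjunction is the finite set of its conjuncts. *)
Notation xorc V := ({fset V} * bool)%type.

Section XorConstraints.
Variable V : choiceType.
Implicit Types (x : V) (D E : xorc V) (t : V -> bool) (phi : {fset xorc V}).

Definition xor_taut : xorc V := (fset0, false).
Definition xor_contra : xorc V := (fset0, true).
Definition lit x (b : bool) : xorc V := ([fset x], b).

(* Symmetric difference on the left: this is cancellation in pairs. *)
Definition lincomb D E : xorc V :=
  ((D.1 `\` E.1) `|` (E.1 `\` D.1), D.2 (+) E.2).

(* D[x/b]; the constant b on the left-hand side is moved into the parity. *)
Definition subst D x (b : bool) : xorc V :=
  if x \in D.1 then (D.1 `\ x, D.2 (+) b) else D.

Definition holds t D : bool := \big[addb/false]_(x <- D.1) t x == D.2.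
Definition models t phi : Prop := forall D, D \in phi -> holds t D.
Definition satisfiable phi : Prop := exists t, models t phi.
Definition entails phi E : Prop := forall t, models t phi -> holds t E.

Definition vars phi : {fset V} := \bigcup_(D <- phi) D.1.

Definition lits (X : {fset V}) (q : V -> bool) : {fset xorc V} :=
  [fset lit x (q x) | x in X].

Definition up_rule D1 D2 E : Prop :=
  exists x b, [/\ D1 = lit x b, x \in D2.1 & E = subst D2 x b].

Fact lincombA : associative lincomb.
Proof.
move=> [A a] [B b] [C c]; rewrite /lincomb /= addbA; congr pair.
apply/fsetP => x; rewrite !inE.
by case: (x \in A); case: (x \in B); case: (x \in C).
Qed.

Fact lincombC : commutative lincomb.
Proof. by move=> D E; rewrite /lincomb fsetUC addbC. Qed.

Fact lincomb0D : left_id xor_taut lincomb.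
Proof. by case=> A p; rewrite /lincomb /= fset0D fsetD0 fset0U. Qed.

HB.instance Definition _ :=
  Monoid.isComLaw.Build (xorc V) xor_taut lincomb
    lincombA lincombC lincomb0D.

End XorConstraints.

Arguments xor_taut {V}.
Arguments xor_contra {V}.

Definition is_input (T : finType) (e : rel T) (v : T) : bool :=
  [forall u, ~~ e u v].

Record up_derivation (V : choiceType) (psi : {fset xorc V}) := UPDerivation {
  vertex : finType;
  edge : rel vertex;
  label : vertex -> xorc V;
  edge_acyclic : forall u v, edge u v -> ~~ connect edge v u;
  label_input : forall v, is_input edge v -> label v \in psi;
  label_noninput : forall v, ~~ is_input edge v ->
    exists u1 u2, [/\ u1 != u2, forall u, edge u v = (u \in [:: u1; u2])
                    & up_rule (label u1) (label u2) (label v)]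
}.

Arguments edge {V psi} G : rename.
Arguments label {V psi} G : rename.

Section ParityExplanation.
Variables (V : choiceType) (phi psi : {fset xorc V}) (G : up_derivation psi).
Let T := vertex G.
Implicit Types (u v : T) (W : {set T} * {set T}).

Definition is_cut W v : Prop :=
  [/\ W.1 :|: W.2 = [set: T], W.1 :&: W.2 = set0,
      ~~ is_input (edge G) v, v \in W.2
    & forall u, is_input (edge G) u -> connect (edge G) u v ->
        u \in W.1].

(* An input label lying both in phi and among the assumptions is explained by
   the tautology.  The big operator ranges over the sources of the edges
   entering u, of which a non-input vertex has exactly two. *)
Definition expl_step W (f : T -> xorc V) u : xorc V :=
  if is_input (edge G) u then
    if label G u \in phi then xor_taut else label G u
  else if u \in W.1 then label G u
  else \big[@lincomb V/xor_taut]_(w | edge G w u) f w.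

(* f_W, by iterating its defining equation: as the graph is acyclic, #|T|
   rounds reach the fixpoint (pexplE). *)
Definition pexpl W : T -> xorc V := iter #|T| (expl_step W) (label G).

Lemma iter_expl_step W n u : #|[pred w | connect (edge G) w u]| <= n ->
  forall m, n <= m ->
  iter m (expl_step W) (label G) u = iter n (expl_step W) (label G) u.
Proof.
elim: n u => [|n IH] u.
  by rewrite leqn0 => /eqP/card0_eq/(_ u); rewrite inE connect0.
move=> le_u [//|m] le_nm; rewrite !iterS /expl_step.
case: ifP => // _; case: ifP => // _.
apply: eq_bigr => w ewu; apply: IH; last exact: le_nm.
rewrite -ltnS; apply: leq_trans le_u; apply: proper_card.
apply/properP; split.
  by apply/subsetP=> z; rewrite !inE => /connect_trans; apply; apply: connect1.
exists u; rewrite !inE ?connect0 //; exact: edge_acyclic ewu.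
Qed.

Lemma pexplE W u : pexpl W u = expl_step W (pexpl W) u.
Proof.
have le_u: #|[pred w | connect (edge G) w u]| <= #|T| by apply: max_card.
by rewrite -[RHS]/(iter #|T|.+1 (expl_step W) (label G) u) (iter_expl_step _ le_u).
Qed.

Lemma pexpl_below W u u1 u2 : ~~ is_input (edge G) u -> u \notin W.1 ->
  u1 != u2 -> (forall w, edge G w u = (w \in [:: u1; u2])) ->
  pexpl W u = lincomb (pexpl W u1) (pexpl W u2).
Proof.
move=> /negPf iu /negPf uW ne12 eu; rewrite pexplE /expl_step iu uW.
rewrite (bigD1 u1) ?eu ?inE ?eqxx //= (bigD1 u2) /=; last first.
  by rewrite eu !inE eqxx orbT eq_sym.
rewrite big1 ?Monoid.mulm1 // => w.
by rewrite eu !inE => /andP[/andP[/orP[] /eqP-> /=]]; rewrite ?eqxx.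
Qed.

End ParityExplanation.

(* Main.v *)
(* Let X be the given set of variables (empty in part 1).  By linear algebra
   some constraints of phi sum to a constraint over X that a suitable
   assignment t violates, where t is true outside X.  Take a subfamily s that is
   connected through shared variables outside X and still has such a sum.
   Outside X each variable occurs an even number of times in s, hence at most
   twice, so s is a graph with constraints as vertices and variables as edges.
   Assume the values of t on X and on the edges off a spanning tree, and
   propagate from the leaves to the root, where a conflict arises.  Each
   constraint and each tree edge is used once and each non-tree edge twice, so
   when the cut separates the inputs from all other vertices, the non-tree
   assumptions cancel and only literals over X remain in the explanation. *)

Require Import Defs.
From mathcomp Require Import all_boot finmap.
From Stdlib Require Import Classical.

Local Open Scope fset_scope.

Set Implicit Arguments.
Unset Strict Implicit.

(** * Sums of constraints modulo two, and connected subfamilies *)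

Definition symdiff (V : choiceType) (A B : {fset V}) := (A `\` B) `|` (B `\` A).

Lemma in_symdiff (V : choiceType) (A B : {fset V}) x :
  (x \in symdiff A B) = (x \in A) (+) (x \in B).
Proof. by rewrite !inE; case: (x \in A); case: (x \in B). Qed.

(** Elements common to [A] and [B] contribute twice and cancel. The operation is [addb] for values
    of assignments and [lincomb] for sums of explanations. *)
Lemma big_symdiff (V : choiceType) (R : Type) (idx : R) (op : Monoid.com_law idx)
    (F : V -> R) (A B : {fset V}) :
    (forall a, op a a = idx) ->
  \big[op/idx]_(x <- symdiff A B) F x =
    op (\big[op/idx]_(x <- A) F x) (\big[op/idx]_(x <- B) F x).
Proof.
move=> opK; have widen (C : {fset V}) : C `<=` A `|` B ->
    \big[op/idx]_(x <- C) F x =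
    \big[op/idx]_(x <- A `|` B) (if x \in C then F x else idx).
  move=> sC; rewrite -(big_fset_incl _ sC) => [|x _ /negPf-> //].
  by apply: eq_fbigr => x ->.
rewrite !widen ?fsubsetUl ?fsubsetUr // -?big_split /=.
  apply: eq_bigr => x _; rewrite in_symdiff.
  by case: (x \in A); case: (x \in B); rewrite /= ?opK ?Monoid.mul1m ?Monoid.mulm1.
by apply/fsubsetP => x; rewrite in_symdiff inE; case: (x \in A); case: (x \in B).
Qed.

Section Parity.
Variable V : choiceType.
Implicit Types (x : V) (A B : {fset V}) (C D E : xorc V) (t : V -> bool).
Implicit Types (s l r : seq (xorc V)).

Lemma lincombK D : lincomb D D = xor_taut.
Proof. by rewrite /lincomb fsetDv fsetU0 addbb. Qed.

(** The negation of [holds], chosen because it is additive under [lincomb]. *)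
Definition defect t D : bool := (\big[addb/false]_(x <- D.1) t x) (+) D.2.

Definition xsum s : xorc V := \big[@lincomb V/xor_taut]_(D <- s) D.

Lemma holdsE t D : holds t D = ~~ defect t D.
Proof. by rewrite /holds /defect; case: (\big[_/_]_(_ <- _) _) D.2 => [] []. Qed.

Lemma defect_lincomb t D E :
  defect t (lincomb D E) = defect t D (+) defect t E.
Proof.
by rewrite /defect [LHS]/= (big_symdiff _ _ _ addbb) /= addbACA.
Qed.

Lemma defect_taut t : defect t xor_taut = false.
Proof. by rewrite /defect big_seq_fset0. Qed.

Lemma defect_contra t : defect t xor_contra = true.
Proof. by rewrite /defect big_seq_fset0. Qed.

Lemma xsum_cons D s : xsum (D :: s) = lincomb D (xsum s).
Proof. by rewrite /xsum big_cons. Qed.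

Lemma in_xsum x s : (x \in (xsum s).1) = odd (count (fun D => x \in D.1) s).
Proof.
elim: s => [|D s IHs]; first by rewrite /xsum big_nil inE.
by rewrite xsum_cons in_symdiff IHs /= oddD oddb.
Qed.

Lemma defect_xsum t s : {in s, forall D, ~~ defect t D} -> ~~ defect t (xsum s).
Proof.
elim: s => [|D s IHs] sol; first by rewrite /xsum big_nil defect_taut.
rewrite xsum_cons defect_lincomb (negPf (sol D _)) ?mem_head //=.
by apply: IHs => E Es; apply: sol; rewrite inE Es orbT.
Qed.

(** Three summands and not two: the constant [D.2] is counted an odd number of times, so solution
    sets are closed under such sums. *)
Lemma defect_addb t1 t2 t3 D :
  defect (fun x => t1 x (+) t2 x (+) t3 x) D =
  defect t1 D (+) defect t2 D (+) defect t3 D.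
Proof.
rewrite /defect !big_split /=.
by do 3!case: (\big[_/_]_(_ <- _) _); case: D.2.
Qed.

(* If none of C, C + D and D + contra followed from l, then the pointwise sum
   of three countermodels would satisfy D :: l but not C. *)
Lemma entails_span l C :
    (forall t, {in l, forall D, ~~ defect t D} -> ~~ defect t C) ->
  exists2 s, subseq s l & xsum s = C \/ xsum s = xor_contra.
Proof.
elim: l C => [|D l IHl] C entC.
  (* With no premises [C] is a tautology: the zero assignment forces its parity to be false, and the
     indicator of a variable of [C] would violate it. *)
  have {}entC t : ~~ defect t C by apply: entC.
  exists [::] => //; left; rewrite /xsum big_nil.
  have C2: C.2 = false.
    by have := entC xpred0; rewrite /defect big1 //= => /negPf.
  suff C1: C.1 = fset0 by case: (C) C1 C2 => ? ? /= -> ->.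
  apply/eqP; case: (fset_0Vmem C.1) => [->//|[x xC]].
  have := entC (pred1 x); rewrite /defect C2 (big_fsetD1 x) //= eqxx.
  by rewrite big1_fset // => y; rewrite !inE => /andP[/negPf].
have counter E : (forall t, {in l, forall D', ~~ defect t D'} -> ~~ defect t E)
    \/ exists2 t, {in l, forall D', ~~ defect t D'} & defect t E.
  have [?|noE] := classic (exists2 t, {in l, forall D', ~~ defect t D'} & defect t E).
    by right.
  by left=> t solt; apply/negP => dE; apply: noE; exists t.
have [/IHl[s sl sC]|[t1 sol1 C1]] := counter C.
  by exists s => //; apply: subseq_trans sl (subseq_cons _ _).
have [/IHl[s sl [sC|sC]]|[t2 sol2]] := counter (lincomb D C).
- exists (D :: s); rewrite /= ?eqxx //; left.
  by rewrite xsum_cons sC lincombA lincombK lincomb0D.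
- by exists s; [apply: subseq_trans sl (subseq_cons _ _)|right].
have [/IHl[s sl [sC|sC]]|[t3 sol3]] := counter (lincomb D xor_contra).
- exists (D :: s); rewrite /= ?eqxx //; right.
  by rewrite xsum_cons sC lincombA lincombK lincomb0D.
- by exists s; [apply: subseq_trans sl (subseq_cons _ _)|right].
rewrite !defect_lincomb defect_contra => D3 CD2.
have solD E : E \in D :: l -> ~~ defect (fun x => t1 x (+) t2 x (+) t3 x) E.
  rewrite inE => /predU1P[->|El]; rewrite defect_addb; last first.
    by rewrite (negPf (sol1 _ El)) (negPf (sol2 _ El)) (negPf (sol3 _ El)).
  have D1 : defect t1 D.
    apply/negPn/negP => nD1; move: C1; apply/negP/entC => E'.
    by rewrite inE => /predU1P[->|/sol1].
  have D2 : defect t2 D.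
    apply/negPn/negP => nD2; have /negPf C2 : ~~ defect t2 C.
      by apply: entC => E'; rewrite inE => /predU1P[->|/sol2].
    by rewrite (negPf nD2) C2 in CD2.
  by rewrite D1 D2; case: (defect t3 D) D3.
have nD3 : ~~ defect t3 D by case: (defect t3 D) D3.
have nC3 : ~~ defect t3 C by apply: entC => E'; rewrite inE => /predU1P[->|/sol3].
have D2C2 : ~~ defect t2 C.
  apply/negP => C2; move: (C2); apply/negP/entC => E'.
  rewrite inE => /predU1P[->|/sol2 //].
  by move: CD2; rewrite C2; case: defect.
by have := entC _ solD; rewrite defect_addb C1 (negPf nC3) (negPf D2C2).
Qed.

(* Every set but the last shares a variable outside X with a later one: read
   from the end, s grows a spanning tree, and its head is a leaf. *)
Fixpoint linked (X : {fset V}) (s : seq {fset V}) : Prop :=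
  if s is A :: s' then
    (s' = [::] \/ exists2 x, x \notin X & (x \in A) && has (fun B => x \in B) s')
    /\ linked X s'
  else True.

(** Greedy growth of a connected component: constraints sharing a variable outside [X] with the
    current family are put in front of it until none remains. *)
Lemma linked_split X s : s != [::] -> exists s1 s2,
  [/\ perm_eq s (s1 ++ s2), s1 != [::], linked X [seq D.1 | D <- s1]
    & forall x, x \notin X ->
        has (fun D => x \in D.1) s1 -> ~~ has (fun D => x \in D.1) s2].
Proof.
move=> s_n0.
have [s1 [r [ss1 s1_n0 link1]]] : exists s1 r, [/\ perm_eq s (s1 ++ r),
    s1 != [::] & linked X [seq D.1 | D <- s1]].
  by case: s s_n0 => // D r _; exists [:: D], r; split=> //=; split=> //; left.
elim: {r}(size r) {-2}r (erefl (size r)) => [|n IHn] r sz_r in s1 ss1 s1_n0 link1 *.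
  by exists s1, r; split=> // x _ _; case: r sz_r {ss1}.
have [[D Dr [x [xX xD xs1]]]|noD] := classic (exists2 D, D \in r &
    exists x, [/\ x \notin X, x \in D.1 & has (fun D => x \in D.1) s1]).
  apply: (IHn (rem D r) _ (D :: s1)) => //=.
  - by rewrite size_rem // sz_r.
  - rewrite (perm_trans ss1) // perm_sym -cat1s.
    by rewrite perm_catCA perm_cat2l cat1s perm_sym perm_to_rem.
  - split=> //; right; exists x; rewrite // xD has_map /=.
    by apply: sub_has xs1.
exists s1, r; split=> // x xX xs1; apply/hasPn => D Dr; apply/negP => xD.
by apply: noD; exists D => //; exists x.
Qed.

Lemma xsum_cat s1 s2 : xsum (s1 ++ s2) = lincomb (xsum s1) (xsum s2).
Proof. by rewrite /xsum big_cat. Qed.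

(** A variable outside [X] occurs in only one of the two pieces of the split, so both sums stay over
    [X]. Their defects add up to true: either the component is violated, or the search continues in
    the remainder. *)
Lemma linked_conflict X t s :
    (xsum s).1 `<=` X -> defect t (xsum s) ->
  exists s1 s2, [/\ perm_eq s (s1 ++ s2), s1 != [::],
    linked X [seq D.1 | D <- s1], (xsum s1).1 `<=` X & defect t (xsum s1)].
Proof.
elim: {s}(size s).+1 {-2}s (ltnSn (size s)) => // n IHn s lt_s_n sX ds.
have s_n0 : s != [::].
  by apply/eqP => s0; rewrite s0 /xsum big_nil defect_taut in ds.
have [s1 [s2 [ss s1_n0 link1 sep]]] := linked_split X s_n0.
have sumE : xsum s = lincomb (xsum s1) (xsum s2).
  by rewrite -xsum_cat; apply: perm_big.
have disj x : x \notin X -> (x \notin (xsum s1).1) && (x \notin (xsum s2).1).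
  move=> xX; have := contra (fsubsetP sX x) xX.
  have := sep x xX; rewrite sumE in_symdiff.
  rewrite !in_xsum !has_count; case: (count _ s1) => [|c] /=; first by move=> _ ->.
  by move/(_ isT); case: (count _ s2) => [_|//]; rewrite /= addbF andbT.
have [s1X s2X] : (xsum s1).1 `<=` X /\ (xsum s2).1 `<=` X.
  by split; apply/fsubsetP => x; apply: contraLR => /disj/andP[].
have [d1|d1] := boolP (defect t (xsum s1)); first by exists s1, s2.
have lt_s2 : size s2 < n.
  rewrite -ltnS (leq_trans _ lt_s_n) // (perm_size ss) size_cat ltnS.
  case: s1 s1_n0 {ss link1 sep sumE disj s1X d1} => //= *.
  by rewrite addSn ltnS leq_addl.
have [|r1 [r2 [rs r1_n0 linkr rX dr]]] := IHn s2 lt_s2 s2X.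
  by move: ds; rewrite sumE defect_lincomb (negPf d1).
exists r1, (s1 ++ r2); split=> //; rewrite (perm_trans ss) //.
by rewrite perm_sym perm_catCA perm_cat2l perm_sym.
Qed.

End Parity.

(** The two copies of [c] cancel. In [derives_conflict], [c] explains the variables substituted into
    a leaf. *)
Lemma lincomb_insert (V : choiceType) (a b c d e : xorc V) :
  lincomb (lincomb a b) (lincomb d e) =
  lincomb (lincomb b (lincomb a c)) (lincomb e (lincomb d c)).
Proof.
rewrite (lincombC a) -!lincombA; congr lincomb; congr lincomb.
rewrite (lincombC c) -!lincombA lincombK (lincombC d); congr lincomb.
by rewrite lincombC lincomb0D.
Qed.

(** * Tree-shaped UP-derivations and their explanations *)

Section Derivations.
Variables (V : choiceType) (phi psi : {fset xorc V}).
Implicit Types (x : V) (X A B : {fset V}) (D E F : xorc V) (t : V -> bool).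

Definition input_expl D : xorc V := if D \in phi then xor_taut else D.

(* derives D F: some tree-shaped UP-derivation on psi has a root labelled D
   whose parity explanation is F, for the cut with all inputs on one side and
   all the other vertices on the other. *)
Inductive derives : xorc V -> xorc V -> Prop :=
| derives_input D : D \in psi -> derives D (input_expl D)
| derives_up D1 F1 D2 F2 E : derives D1 F1 -> derives D2 F2 ->
    up_rule D1 D2 E -> derives E (lincomb F1 F2).

(** This makes every UP step linear. *)
Lemma subst_lincomb D x b : x \in D.1 -> subst D x b = lincomb D (lit x b).
Proof.
move=> xD; rewrite /subst xD; congr pair; apply/fsetP => y.
by rewrite in_symdiff !inE; case: eqP => [->|_]; rewrite ?xD //= addbF.
Qed.

Lemma derives_lit D F x b FL : derives D F -> derives (lit x b) FL ->
  x \in D.1 -> derives (lincomb D (lit x b)) (lincomb F FL).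
Proof.
move=> dD dL xD; rewrite (lincombC F); apply: derives_up dL dD _.
by exists x, b; rewrite subst_lincomb.
Qed.

(** Labels and explanations are added alike at each UP step, so it suffices to look at inputs, where
    the sum is a conjunct of [phi] or [xor_taut]. *)
Lemma derives_entails D F t : derives D F ->
  {in phi, forall E, ~~ defect t E} -> ~~ defect t (lincomb D F).
Proof.
move=> dD sol; elim: dD => [{}D _|D1 F1 D2 F2 E _ IH1 _ IH2 [x [b [D1E xD2 ->]]]].
  rewrite /input_expl; case: ifPn => Dphi; last by rewrite lincombK defect_taut.
  by rewrite lincombC lincomb0D sol.
rewrite subst_lincomb // -D1E; move: IH1 IH2; rewrite !defect_lincomb.
by do 4!case: defect.
Qed.

Variables (t : V -> bool) (U : {fset V}).
Hypothesis lit_psi : {in U, forall x, lit x (t x) \in psi}.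

(** [input_expl] is applied because an assumed literal may also be a conjunct of [phi], and is then
    explained by [xor_taut]. *)
Definition lits_expl A : xorc V :=
  \big[@lincomb V/xor_taut]_(x <- A) input_expl (lit x (t x)).

Lemma lits_expl_lincomb D E :
  lits_expl (lincomb D E).1 = lincomb (lits_expl D.1) (lits_expl E.1).
Proof. exact: big_symdiff (@lincombK V). Qed.

Lemma derives_lits D F A : derives D F -> A `<=` D.1 -> A `<=` U ->
  derives (lincomb D (A, \big[addb/false]_(x <- A) t x)) (lincomb F (lits_expl A)).
Proof.
move=> dD; elim: {A}#|`A| {-2}A (erefl #|`A|) => [|n IHn] A sz_A sAD sAU.
  move/cardfs0_eq: sz_A => ->; rewrite /lits_expl !big_seq_fset0.
  by rewrite !(lincombC _ (_, _)) !lincomb0D.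
have [A0|[x xA]] := fset_0Vmem A; first by rewrite A0 cardfs0 in sz_A.
have sz_Ax : #|` A `\ x| = n by move: sz_A; rewrite (cardfsD1 x) xA => -[].
have sAxA := fsubsetDl A [fset x].
have dAx := IHn _ sz_Ax (fsubset_trans sAxA sAD) (fsubset_trans sAxA sAU).
have dx := derives_input (lit_psi (fsubsetP sAU _ xA)).
rewrite /lits_expl (big_fsetD1 x xA) /= (big_fsetD1 x xA) /=.
rewrite -/(lits_expl _) (lincombC (input_expl _)) lincombA.
have := derives_lit dAx dx; rewrite -!lincombA => step.
have <- : lincomb (A `\ x, \big[addb/false]_(y <- A `\ x) t y) (lit x (t x)) =
    (A, t x (+) \big[addb/false]_(y <- A `\ x) t y).
  rewrite addbC; congr pair; apply/fsetP => y.
  by rewrite in_symdiff !inE; case: eqP => [->|_]; rewrite ?xA //= addbF.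
apply: step; rewrite in_symdiff !inE eqxx /= addbF; exact: (fsubsetP sAD).
Qed.

Lemma xsum_add (T : Type) (f : T -> xorc V) (a : pred T) L (s : seq T) :
  xsum [seq if a p then lincomb (f p) L else f p | p <- s] =
    lincomb (xsum [seq f p | p <- s]) (if odd (count a s) then L else xor_taut).
Proof.
elim: s => [|p s IHs]; first by rewrite /xsum big_nil lincomb0D.
rewrite /= !xsum_cons IHs oddD oddb; case: (a p) => /=; last by rewrite lincombA.
rewrite -!lincombA; congr lincomb; rewrite lincombC -lincombA; congr lincomb.
by case: odd => /=; rewrite ?lincombK // lincomb0D.
Qed.

(** A variable that realises a link occurs at least twice, so only such variables have to be
    preserved. *)
Lemma sub_linked (T : Type) (f g : T -> {fset V}) X X' (s : seq T) :
    (forall x, x \notin X -> 1 < count (fun p => x \in f p) s ->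
       x \notin X' /\ forall p, (x \in g p) = (x \in f p)) ->
  linked X [seq f p | p <- s] -> linked X' [seq g p | p <- s].
Proof.
elim: s => //= p s IHs keep [leaf link]; split; last first.
  apply: IHs link => x xX lt1; apply: keep => //.
  by rewrite (leq_trans lt1) // leq_addl.
case: leaf => [s0|[x xX /andP[xp xs]]]; first by left; case: (s) s0.
have [|xX' fg] := keep x xX.
  by rewrite xp ltnS -has_count; rewrite has_map in xs.
right; exists x => //; rewrite fg xp; move: xs; rewrite !has_map.
by apply: sub_has => q; rewrite /= fg.
Qed.

(* The head of s is a leaf D, tied to the tree by x: substituting its other
   variables B gives a literal on x, which is added to the only other
   constraint containing x.  B then joins X; its variables outside X have at
   most one occurrence left. *)
Lemma derives_conflict X (s : seq (xorc V * xorc V)) :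
    s != [::] -> linked X [seq p.1.1 | p <- s] ->
    {in s, forall p, derives p.1 p.2 /\ p.1.1 `<=` U} ->
    (forall x, x \notin X -> count (fun p : xorc V * xorc V => x \in p.1.1) s <= 2) ->
    defect t (xsum [seq p.1 | p <- s]) ->
  derives xor_contra (lincomb (xsum [seq p.2 | p <- s])
                              (lits_expl (xsum [seq p.1 | p <- s]).1)).
Proof.
elim: {s}(size s) {-2}s (erefl (size s)) => [|n IHn] [|[D F] s] // [sz_s] in X *.
move=> _ [leaf link] ders le2 ds.
have [/= dD sDU] := ders _ (mem_head _ _).
case: leaf => [s0|[x xX /= /andP[xD]]].
  (* A single constraint is left: substituting all its variables leaves its defect as parity, which
     is true. *)
  have {s0} s0 : s = [::] by case: (s) s0.
  move: ds; rewrite {}s0 {ders le2 link sz_s} /= !xsum_cons /xsum !big_nil.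
  rewrite !(lincombC _ xor_taut) !lincomb0D => dD1.
  have := derives_lits dD (fsubset_refl _) sDU.
  by rewrite /lincomb /xor_contra /= fsetDv fsetU0 addbC -/(defect t D) dD1.
rewrite has_map => xs.
pose B := D.1 `\ x; pose b := D.2 (+) \big[addb/false]_(y <- B) t y.
pose FL := lincomb F (lits_expl B).
have sBD : B `<=` D.1 by exact: fsubsetDl.
have LE : lincomb D (B, \big[addb/false]_(y <- B) t y) = lit x b.
  congr pair; apply/fsetP => y; rewrite in_symdiff !inE.
  by case: eqP => [->|_]; rewrite ?xD //= addbb.
have dL : derives (lit x b) FL.
  by rewrite -LE; apply: derives_lits => //; apply: fsubset_trans sDU.
pose upd (p : xorc V * xorc V) :=
  if x \in p.1.1 then (lincomb p.1 (lit x b), lincomb p.2 FL) else p.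
have in_upd y p : y != x -> (y \in (upd p).1.1) = (y \in p.1.1).
  rewrite /upd; case: ifP => // _ /negPf yx; by rewrite in_symdiff !inE yx addbF.
have x1 : count (fun p => x \in p.1.1) s = 1%N.
  apply/eqP; rewrite eqn_leq -has_count xs andbT.
  by have := le2 x xX; rewrite /= xD.
have x_upd p : x \notin (upd p).1.1.
  by rewrite /upd; case: ifPn => // xp; rewrite in_symdiff xp inE eqxx.
have sum1 : xsum [seq p.1 | p <- [seq upd p | p <- s]] =
    lincomb (xsum [seq p.1 | p <- s]) (lit x b).
  have := xsum_add (fun p => p.1) (fun p => x \in p.1.1) (lit x b) s; rewrite x1 => <-.
  by rewrite -map_comp; congr xsum; apply: eq_map => p /=; rewrite /upd; case: ifP.
have sum2 : xsum [seq p.2 | p <- [seq upd p | p <- s]] =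
    lincomb (xsum [seq p.2 | p <- s]) FL.
  have := xsum_add (fun p => p.2) (fun p => x \in p.1.1) FL s; rewrite x1 => <-.
  by rewrite -map_comp; congr xsum; apply: eq_map => p /=; rewrite /upd; case: ifP.
have LxE : lits_expl [fset x] = lincomb (lits_expl D.1) (lits_expl B).
  exact: etrans (congr1 (fun E => lits_expl E.1) (esym LE)) (lits_expl_lincomb _ _).
have := IHn [seq upd p | p <- s] _ (X `|` B); rewrite sum1 sum2.
rewrite (lits_expl_lincomb _ (lit x b)) LxE /=.
rewrite !xsum_cons (lits_expl_lincomb D).
rewrite (lincomb_insert F _ (lits_expl B)) => IH.
apply: IH.
- by rewrite size_map.
- by case: (s) xs.
- rewrite -map_comp; apply: sub_linked link => y yX lt1.
  (* If [D] contained [y], the two occurrences left in [s] would make three. Hence links among the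
     remaining constraints avoid [B] and [x]. *)
  have yD : y \notin D.1.
    apply/negP => yD; have := le2 y yX; rewrite /= yD.
    by rewrite leqNgt ltnS lt1.
  split=> [|p]; first by rewrite !inE negb_or yX (negPf yD) andbF.
  by apply: in_upd; apply: contraNneq yD => ->.
- move=> q qs; have [p ps ->] := mapP qs; have [|dp sp] := ders p.
    by rewrite inE ps orbT.
  rewrite /upd; case: ifP => //= xp; split; first exact: derives_lit.
  apply/fsubsetP => y; rewrite in_symdiff inE; case: eqP => [->|_].
    by rewrite xp.
  by rewrite addbF; apply: (fsubsetP sp).
- move=> y; rewrite !inE negb_or => /andP[yX _].
  rewrite count_map; apply: leq_trans (le2 y yX).
  rewrite /= (leq_trans _ (leq_addl _ _)) //.
  apply: sub_count => p /=; have [->|/in_upd-> //] := eqVneq y x.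
  by rewrite (negPf (x_upd p)).
(* The propagated literal differs from [D] by a constraint that [t] satisfies, so adding it to the
   tail accounts exactly for the defect of [D]. *)
- have db : defect t (lit x b) = defect t D.
    by rewrite -LE defect_lincomb [defect t (B, _)]/defect addbb addbF.
  by move: ds; rewrite /= xsum_cons !defect_lincomb db addbC.
Qed.

End Derivations.

(** * From derivation trees to labelled graphs with cuts *)

Section Realization.
Variables (V : choiceType) (phi psi : {fset xorc V}).
Implicit Types (D F : xorc V).

Definition explained (T : finType) (e : rel T) (L f : T -> xorc V) (w : T) : Prop :=
  [/\ forall u, ~~ e u w, L w \in psi & f w = input_expl phi (L w)] \/
  exists u1 u2, [/\ u1 != u2, forall u, e u w = (u \in [:: u1; u2]),
    up_rule (L u1) (L u2) (L w) & f w = lincomb (f u1) (f u2)].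

(** Disjoint copies of both graphs with a new sink [None]. The two sources of its edges lie in
    different copies, hence are distinct. *)
Definition join_edge (T1 T2 : finType) (e1 : rel T1) (e2 : rel T2) v1 v2 :
    rel (option (T1 + T2)) := fun a b =>
  match a, b with
  | Some (inl u), Some (inl w) => e1 u w
  | Some (inr u), Some (inr w) => e2 u w
  | Some (inl u), None => u == v1
  | Some (inr u), None => u == v2
  | _, _ => false
  end.

Definition join_fun (T1 T2 R : Type) (f1 : T1 -> R) (f2 : T2 -> R) (z : R)
    (a : option (T1 + T2)) : R :=
  match a with Some (inl u) => f1 u | Some (inr u) => f2 u | None => z end.

(* The rank r witnesses acyclicity, and f solves the defining equations of the
   parity explanation. *)
Lemma derives_explained D F : derives phi psi D F ->
  exists (T : finType) (e : rel T) (L f : T -> xorc V) (r : T -> nat) (v : T),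
    [/\ L v = D, f v = F, forall u w, e u w -> r u < r w
      & forall w, explained e L f w].
Proof.
elim=> [{}D Dpsi|D1 F1 D2 F2 E _ [T1 [e1 [L1 [f1 [r1 [v1 [<- <- re1 ex1]]]]]]]
                 _ [T2 [e2 [L2 [f2 [r2 [v2 [<- <- re2 ex2]]]]]]] upE].
  exists unit, (fun _ _ => false), (fun=> D), (fun=> input_expl phi D), (fun=> 0), tt.
  by split=> // w; left.
exists (option (T1 + T2)), (join_edge e1 e2 v1 v2), (join_fun L1 L2 E),
  (join_fun f1 f2 (lincomb (f1 v1) (f2 v2))),
  (join_fun r1 r2 (maxn (r1 v1) (r2 v2)).+1), None.
split=> //.
- move=> [[u|u]|] [[w|w]|] //=; first exact: re1; last 1 first.
  + by move/eqP->; rewrite ltnS leq_maxr.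
  + by move/eqP->; rewrite ltnS leq_maxl.
  + exact: re2.
- move=> [[w|w]|].
  + case: (ex1 w) => [[no Lw fw]|[u1 [u2 [ne12 eE up fw]]]].
      by left; split=> // -[[u|u]|] //=.
    right; exists (Some (inl u1)), (Some (inl u2)); split=> //.
    by case=> [[u|u]|] //=; rewrite eE !inE.
  + case: (ex2 w) => [[no Lw fw]|[u1 [u2 [ne12 eE up fw]]]].
      by left; split=> // -[[u|u]|] //=.
    right; exists (Some (inr u1)), (Some (inr u2)); split=> //.
    by case=> [[u|u]|] //=; rewrite eE !inE.
  + right; exists (Some (inl v1)), (Some (inr v2)); split=> //.
    by case=> [[u|u]|] //=; rewrite !inE ?orbF.
Qed.

(** Since [D] is not in [psi], the root cannot be an input, as a cut for it requires. *)
Lemma derives_realized D F : derives phi psi D F -> D \notin psi ->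
  exists (G : up_derivation psi) (v : vertex G) (W : {set vertex G} * {set vertex G}),
    [/\ label G v = D, is_cut W v & pexpl phi W v = F].
Proof.
move=> /derives_explained[T [e [L [f [r [v [<- <- re ex]]]]]]] vpsi.
have acyc u w : e u w -> ~~ connect e w u.
  move=> /re lt_uw; apply/negP => /connectP[p path_p uE]; move: lt_uw.
  rewrite ltnNge uE => /negP; apply; elim: p w path_p {uE} => //= x p IHp w.
  by case/andP=> /re/ltnW lt_wx /IHp; apply: leq_trans.
have in_lab w : is_input e w -> L w \in psi.
  move=> /forallP no; case: (ex w) => [[]//|[u1 [u2 [_ eE _ _]]]].
  by have := no u1; rewrite eE mem_head.
have nin_lab w : ~~ is_input e w -> exists u1 u2, [/\ u1 != u2,
    forall u, e u w = (u \in [:: u1; u2]) & up_rule (L u1) (L u2) (L w)].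
  move=> /negP nw; case: (ex w) => [[no _ _]|[u1 [u2 [? ? ? _]]]].
    by case: nw; apply/forallP.
  by exists u1, u2.
pose G := UPDerivation acyc in_lab nin_lab.
pose W := ([set u | is_input e u], [set u | ~~ is_input e u]).
exists G, v, W; split=> //.
  split; rewrite ?inE //=.
  - by apply/setP => u; rewrite !inE orbN.
  - by apply/setP => u; rewrite !inE andbN.
  - by apply: contra vpsi; exact: in_lab.
  - by apply: contra vpsi; exact: in_lab.
  - by move=> u ? _; rewrite inE.
(* Induction on the rank identifies [pexpl] with the solution [f] of its defining equations. *)
elim: {v vpsi}(r v).+1 {-2}v (ltnSn (r v)) => // n IHn v le_n.
case: (ex v) => [[no _ ->]|[u1 [u2 [ne12 eE _ ->]]]].
  have iv : is_input e v by apply/forallP.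
  by rewrite pexplE /expl_step /= iv.
have niv : ~~ is_input e v.
  by apply/negP => /forallP/(_ u1); rewrite eE mem_head.
have lt_n u : e u v -> r u < n by move/re => lt_uv; apply: leq_trans lt_uv _.
by rewrite (@pexpl_below _ phi _ G W v u1 u2) ?inE // !IHn ?lt_n // eE !inE eqxx ?orbT.
Qed.

End Realization.

(** The common core of both parts of the theorem, with [X] empty in the first one. *)
Lemma refutation_explained (V : choiceType) (phi psi : {fset xorc V})
    (X : {fset V}) (t : V -> bool) (s : seq (xorc V)) :
    (forall x : V, (#|` [fset D in phi | x \in D.1]| <= 3)%N) ->
    phi `<=` psi -> {in vars phi, forall x, lit x (t x) \in psi} ->
    xor_contra \notin psi -> subseq s phi -> (xsum s).1 `<=` X -> defect t (xsum s) ->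
  exists (G : up_derivation psi) (v : vertex G) (W : {set vertex G} * {set vertex G})
      (A : {fset V}),
    [/\ label G v = xor_contra, is_cut W v, A `<=` X,
        pexpl phi W v = lits_expl phi t A
      & entails phi (lincomb (pexpl phi W v) xor_contra)].
Proof.
move=> three phi_psi lit_psi contra_psi s_phi sX ds.
have [s1 [s2 [ss s1_n0 link s1X ds1]]] := linked_conflict sX ds.
have s1_phi : {subset s1 <= phi}.
  by move=> D Ds1; rewrite (mem_subseq s_phi) // (perm_mem ss) mem_cat Ds1.
have le2 x : x \notin X -> count (fun D => x \in D.1) s1 <= 2.
  move=> xX; have le3 : count (fun D => x \in D.1) s1 <= 3.
    apply: leq_trans (three x); apply: (@leq_trans (count (fun D => x \in D.1) s)).
      by rewrite (permP ss) count_cat leq_addr.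
    apply: leq_trans (leq_count_subseq _ s_phi) _; rewrite -size_filter.
    apply: uniq_leq_size; first exact/filter_uniq/fset_uniq.
    by move=> D; rewrite mem_filter !inE andbC.
  (* Outside [X] the number of occurrences is even, so three is excluded. *)
  have := contra (fsubsetP s1X x) xX; rewrite in_xsum.
  by case: count le3 => [|[|[|[|]]]].
pose ps := [seq (D, xor_taut : xorc V) | D <- s1].
have ps1 : [seq p.1 | p <- ps] = s1 by rewrite -map_comp map_id.
have ps2 : xsum [seq p.2 | p <- ps] = xor_taut.
  rewrite /ps -map_comp; elim: (s1) => [|D r IHr]; first by rewrite /xsum big_nil.
  by rewrite /= xsum_cons lincomb0D.
have der : derives phi psi xor_contra (lits_expl phi t (xsum s1).1).
  have := @derives_conflict V phi psi t (vars phi) lit_psi X ps.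
  rewrite ps1 ps2 lincomb0D; apply=> //.
  - by rewrite /ps; case: (s1) s1_n0.
  - by rewrite /ps -map_comp.
  - move=> p /mapP[D Ds1 ->] /=; have Dphi := s1_phi D Ds1; split.
      have := derives_input phi (fsubsetP phi_psi _ Dphi).
      by rewrite /input_expl Dphi.
    exact: bigfcup_sup.
  - by move=> x xX; rewrite count_map; apply: le2.
have [G [v [W [Lv cutW pE]]]] := derives_realized der contra_psi.
exists G, v, W, (xsum s1).1; split=> // t' sol; rewrite holdsE pE lincombC.
by apply: derives_entails der _ => D Dphi; rewrite -holdsE sol.
Qed.

Unset Implicit Arguments.
Set Strict Implicit.

Theorem theorem3 (V : choiceType) (phi : {fset xorc V})
    (three : forall x : V, (#|` [fset D in phi | x \in D.1]| <= 3)%N) :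
  (~ satisfiable phi -> xor_contra \notin phi ->
    exists (Y : {fset V}) (G : up_derivation (phi `|` lits Y xpredT))
           (v : vertex G) (W : {set vertex G} * {set vertex G}),
      [/\ Y `<=` vars phi, label G v = xor_contra, is_cut W v,
          pexpl phi W v = xor_taut
        & lincomb (pexpl phi W v) (label G v) = xor_contra])
  /\
  (forall (X : {fset V}) (p : bool), X != fset0 ->
    satisfiable phi -> entails phi (X, p) ->
    exists (q : V -> bool) (Y : {fset V})
           (G : up_derivation (phi `|` lits X q `|` lits Y xpredT))
           (v : vertex G) (W : {set vertex G} * {set vertex G}),
      [/\ Y `<=` vars phi `\` X, label G v = xor_contra, is_cut W v
        & exists (X' : {fset V}) (p' : bool),
            [/\ X' `<=` X,
                lincomb (pexpl phi W v) (label G v) = (X', p')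
              & entails phi (X', p')]]).
Proof.
have lit_contra (Y : {fset V}) q : xor_contra \notin lits Y q.
  apply/negP => /imfsetP[x _ [/fsetP/(_ x)]]; by rewrite !inE eqxx.
have in_lits (Y : {fset V}) q x : x \in Y -> lit x (q x) \in lits Y q.
  by move=> xY; apply/imfsetP; exists x.
split=> [unsat no_contra | X p X_n0 sat ent].
  (* For [C] equal to [xor_contra] the two outcomes of [entails_span] coincide. *)
  have [s s_phi sE] : exists2 s, subseq s phi & xsum s = xor_contra.
    have [|s s_phi sE] := @entails_span V phi xor_contra.
      move=> t sol; case: unsat; exists t => D Dphi; rewrite holdsE; exact: sol.
    by exists s => //; case: sE.
  have [|||//|||G [v [W [A [Lv cutW AX pE _]]]]] :=
      @refutation_explained V phi (phi `|` lits (vars phi) xpredT) fset0 xpredT s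
        three.
  - exact: fsubsetUl.
  - by move=> x xphi; rewrite inE in_lits ?orbT.
  - by rewrite inE negb_or no_contra lit_contra.
  - by rewrite sE fsub0set.
  - by rewrite sE defect_contra.
  have pT : pexpl phi W v = xor_taut.
    rewrite pE; move: AX; rewrite fsubset0 => /eqP->.
    by rewrite /lits_expl big_seq_fset0.
  by exists (vars phi), G, v, W; rewrite pT Lv lincomb0D fsubset_refl.
have [t0 sol0] := sat.
have sol0' s : {subset s <= phi} -> ~~ defect t0 (xsum s).
  by move=> s_phi; apply: defect_xsum => D /s_phi/sol0; rewrite holdsE.
have no_contra : xor_contra \notin phi.
  by apply/negP => /sol0; rewrite holdsE defect_contra.
have [s s_phi sE] : exists2 s, subseq s phi & xsum s = (X, p).
  have [|s s_phi [sE|sE]] := @entails_span V phi (X, p).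
  - by move=> t sol; rewrite -holdsE; apply: ent => D /sol; rewrite holdsE.
  - by exists s.
  (* A sum equal to [xor_contra] would be violated by the solution [t0]. *)
  by have := sol0' s (mem_subseq s_phi); rewrite sE defect_contra.
have [X0|[x0 x0X]] := fset_0Vmem X; first by rewrite X0 eqxx in X_n0.
(* The parities of [q] over [X] add up to the negation of [p]: [x0] carries it and all other
   variables are false. *)
pose q x := (x == x0) && ~~ p.
pose t x := if x \in X then q x else true.
have tq : defect t (X, p).
  rewrite /defect (big_fsetD1 x0) //= {1}/t x0X /q eqxx /= big1_fset.
    by case: (p).
  by move=> x; rewrite !inE /t /q => /andP[/negPf-> ->].
have [|||//|||G [v [W [A [Lv cutW AX pE entF]]]]] :=
    @refutation_explained V phi (phi `|` lits X q `|` lits (vars phi `\` X) xpredT)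
      X t s three.
- by rewrite -fsetUA fsubsetUl.
- move=> x xphi; rewrite /t !in_fsetU; case: ifPn => xX.
    by rewrite in_lits ?orbT.
  by apply/orP; right; apply: (in_lits _ xpredT); rewrite inE xX.
- by rewrite !in_fsetU !negb_or no_contra !lit_contra.
- by rewrite sE.
- by rewrite sE.
exists q, (vars phi `\` X), G, v, W; split=> //.
(* Adding [xor_contra] keeps the variables and flips the parity. *)
exists (pexpl phi W v).1, (~~ (pexpl phi W v).2).
have FE : lincomb (pexpl phi W v) xor_contra =
    ((pexpl phi W v).1, ~~ (pexpl phi W v).2).
  by rewrite /lincomb fsetD0 fset0D fsetU0 addbT.
split; last by rewrite -FE.
- rewrite pE; apply: fsubset_trans AX; rewrite /lits_expl big_seq.
  elim/big_ind: _ => [|D E sD sE'|x xA]; first exact: fsub0set.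
    apply/fsubsetP => x; rewrite in_symdiff => xDE.
    case xD: (x \in D.1) xDE; first by move=> _; apply: (fsubsetP sD).
    by apply: (fsubsetP sE').
  rewrite /input_expl; case: ifP => _; first exact: fsub0set.
  by rewrite fsub1set.
- by rewrite Lv FE.
Qed.
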